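(* For each integer $n\ge2$ let $m=m(n)$ be an integer with $1\le m\le n/2$ and $m\in[n/4,\,n/4+1]$. Then $$\lim_{n\to\infty}\dim_H F_{\{n/m\}}=1,$$ where $\dim_H$ denotes Hausdorff dimension.
   Context: Identify the plane with $\mathbb{C}$. For integers $n\ge 2$ and $1\le m\le n/2$ put $$P(n,m)=\frac{\sin(\pi/n)}{2\cos\big((m-1)\pi/n\big)\,\sin(m\pi/n)}.$$ Let $a_k=e^{2\pi i k/n}$ and $S_k(z)=P(n,m)\,z+(1-P(n,m))\,a_k$ for $k=1,\dots,n$. $F_{\{n/m\}}$ (the Sierpinski $n$-gon) is the attractor of this iterated function system, i.e. the unique nonempty compact set with $F_{\{n/m\}}=\bigcup_{k=1}^n S_k(F_{\{n/m\}})$. *)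

(* Defs.v *)
From mathcomp Require Import all_boot all_order all_algebra complex.
From mathcomp Require Import all_classical all_reals all_analysis.

Set Implicit Arguments.
Unset Strict Implicit.
Unset Printing Implicit Defensive.

Import Order.TTheory GRing.Theory Num.Theory.
Import numFieldNormedType.Exports.

Local Open Scope classical_set_scope.
Local Open Scope ring_scope.
Local Open Scope complex_scope.

(* The plane is R[i]. The norm of the numFieldType R[i] is R[i]-valued (with
   real values), hence Re. *)
Definition cdist (R : realType) (z w : R[i]) : R := complex.Re `|z - w|.

(* The supremum of an empty set being -oo, the maximum sets diam set0 = 0. *)
Definition diam (R : realType) (A : set R[i]) : \bar R :=
  maxe 0%E (ereal_sup [set (cdist p.1 p.2)%:E | p in A `*` A]).

(* The empty set always contributes 0, also when s = 0; a singleton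
   contributes 0 `^ 0 = 1 when s = 0. *)
Definition diam_pow (R : realType) (s : R) (A : set R[i]) : \bar R :=
  if A == set0 then 0%E else poweR (diam A) s.

Definition hausdorff_premeasure (R : realType) (s delta : R) (A : set R[i])
  : \bar R :=
  ereal_inf [set (\sum_(0 <= i <oo) diam_pow s (U i))%E
            | U in [set U : nat -> set R[i] |
                     (forall i, (diam (U i) <= delta%:E)%E) /\
                     A `<=` \bigcup_i U i]].

(* As delta decreases the premeasures increase, so the supremum is the limit
   for delta -> 0+. *)
Definition hausdorff_measure (R : realType) (s : R) (A : set R[i]) : \bar R :=
  ereal_sup [set hausdorff_premeasure s delta A
            | delta in [set delta : R | 0 < delta]].

Definition hausdorff_dim (R : realType) (A : set R[i]) : \bar R :=
  ereal_inf [set s%:E | s in [set s : R | 0 <= s /\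
                                          hausdorff_measure s A = 0%E]].

(* The ascription R[i]^o selects the topology given by the norm of R[i]. *)
Definition is_attractor (R : realType) (n : nat) (S : nat -> R[i] -> R[i])
    (K : set R[i]) : Prop :=
  [/\ K !=set0, compact (K : set R[i]^o) &
      K = \bigcup_(k in [set k | (1 <= k <= n)%N]) S k @` K].

(* For finitely many (n >= 1) contractions there is exactly one such K
   (Hutchinson); set0 is only the default value when there is none. *)
Definition attractor (R : realType) (n : nat) (S : nat -> R[i] -> R[i])
  : set R[i] := xget set0 [set K | is_attractor n S K].

Definition ngon_ratio (R : realType) (n m : nat) : R :=
  sin (pi / n%:R) /
  (2 * cos ((m%:R - 1) * pi / n%:R) * sin (m%:R * pi / n%:R)).

Definition ngon_vertex (R : realType) (n k : nat) : R[i] :=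
  cos (2 * pi * k%:R / n%:R) +i* sin (2 * pi * k%:R / n%:R).

Definition ngon_map (R : realType) (n m k : nat) (z : R[i]) : R[i] :=
  (ngon_ratio R n m)%:C * z + (1 - ngon_ratio R n m)%:C * ngon_vertex R n k.

Definition sierpinski_ngon (R : realType) (n m : nat) : set R[i] :=
  attractor n (@ngon_map R n m).
Arguments sierpinski_ngon : clear implicits.

(* Main.v *)
(* The projection Re maps the attractor F onto the attractor in R of the maps
   x |-> P x + (1 - P) cos (2 pi k / n). With s = sin (pi / n) and
   S = sin ((2 m - 1) pi / n) one has P = s / (S + s), and the images under these
   maps of the convex hull of the points cos (2 pi k / n) cover that hull: this
   reduces to S sin u <= (1 - min_k cos (2 pi k / n)) / 2 for odd multiples u of
   pi / n, where the right-hand side is 1 for n even and cos (pi / (2 n)) ^ 2 for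
   n odd. So Re F contains an interval, and dim F >= 1 as Re is 1-Lipschitz.
   Conversely F is covered by n ^ k pieces of diameter at most C P ^ k, so
   dim F <= s as soon as n P ^ s < 1; for m close to n / 4 one has P = O(1 / n),
   hence n P ^ s --> 0 for every s > 1. *)
Require Import Defs.
From mathcomp Require Import all_boot all_order all_algebra complex.
From mathcomp Require Import all_classical all_reals all_analysis.
From mathcomp Require Import ring lra.
Import Order.TTheory GRing.Theory Num.Theory.
Import numFieldNormedType.Exports.
Local Open Scope classical_set_scope.
Local Open Scope ring_scope.

(** * Distance, real and imaginary parts, and compactness in the plane *)

Section Plane.
Context {R : realType}.
Implicit Types (z w : R[i]) (A : set R[i]).
Local Notation C := (R[i]^o).

Lemma cdistE z w : `|z - w| = (cdist z w)%:C%C.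
Proof. by rewrite /cdist normc_def. Qed.

Lemma cdist_ge0 z w : 0 <= cdist z w.
Proof. by rewrite /cdist normc_def sqrtr_ge0. Qed.

Lemma Re_cdist z w : `|complex.Re z - complex.Re w| <= cdist z w.
Proof.
have := normc_ge_Re (z - w); rewrite cdistE lecE /= => /andP[_].
by case: z w => [a b] [c d].
Qed.

Lemma Im_cdist z w : `|complex.Im z - complex.Im w| <= cdist z w.
Proof.
rewrite /cdist normc_def; case: z w => [a b] [c d] /=.
by rewrite -sqrtr_sqr ler_wsqrtr // lerDr sqr_ge0.
Qed.

Lemma cdist_Re_Im z w :
  cdist z w <= `|complex.Re z - complex.Re w| + `|complex.Im z - complex.Im w|.
Proof.
rewrite /cdist normc_def; case: z w => [a b] [c d] /=.
rewrite -[leRHS]ger0_norm ?addr_ge0// -sqrtr_sqr ler_wsqrtr //.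
rewrite -(real_normK (num_real (a - c))) -(real_normK (num_real (b - d))).
have := normr_ge0 (a - c); have := normr_ge0 (b - d); nra.
Qed.

(** Balls of [R[i]^o] have their radii in [R[i]]; this is the passage to real radii on which the
    continuity proofs rest. *)
Lemma near_cdist z (e : R) : 0 < e -> \forall w \near (z : C), cdist z w < e.
Proof.
move=> e0.
have e0' : 0 < e%:C%C :> R[i] by rewrite ltcE /= eqxx.
apply/nbhs_ballP; exists e%:C%C => //= w.
by rewrite -ball_normE /= [X in X < _]cdistE ltcE /= => /andP[].
Qed.

Lemma continuous_Re : continuous (@complex.Re R : C -> R).
Proof.
move=> z; have F : Filter (nbhs (z : C)) := nbhs_filter _.
apply/(@cvgrPdist_lt _ R^o _ _ F) => e e0.
by apply: (@filterS _ _ (nbhs_filter (z : C)) _ _ _ (near_cdist z _ e0)) => w; apply: le_lt_trans (Re_cdist z w).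
Qed.

Lemma continuous_Im : continuous (@complex.Im R : C -> R).
Proof.
move=> z; have F : Filter (nbhs (z : C)) := nbhs_filter _.
apply/(@cvgrPdist_lt _ R^o _ _ F) => e e0.
by apply: (@filterS _ _ (nbhs_filter (z : C)) _ _ _ (near_cdist z _ e0)) => w; apply: le_lt_trans (Im_cdist z w).
Qed.

Lemma continuous_Complex : continuous ((fun p => Complex p.1 p.2) : R * R -> C).
Proof.
move=> [a b]; apply/cvgrPdist_lt => e; rewrite ltcE /= => /andP[/eqP e2 e0].
near=> p.
rewrite [X in X < _]cdistE ltcE /= e2 eqxx /=.
apply: le_lt_trans (cdist_Re_Im _ _) _ => /=.
rewrite [ltRHS]splitr ltrD //; near: p.
  apply: (@cvgr_dist_lt _ R^o _ _ _ fst) => //; [exact: cvg_fst|exact: divr_gt0].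
apply: (@cvgr_dist_lt _ R^o _ _ _ snd) => //; [exact: cvg_snd|exact: divr_gt0].
Unshelve. all: by end_near. Qed.

(** Both coordinates are continuous, hence bounded on [K], and they control the distance. *)
Lemma compact_cdist_bounded (K : set R[i]) : compact (K : set C) ->
  exists2 D : R, 0 <= D & forall z w, K z -> K w -> cdist z w <= D.
Proof.
move=> cK.
have bnd (f : C -> R) : continuous f ->
    exists2 M : R, 0 <= M & forall z, K z -> `|f z| <= M.
  move=> cf.
  have /compact_bounded [M [_ HM]] : compact (f @` K : set R^o).
    by apply: (@continuous_compact C R^o f K) => //; apply: continuous_subspaceT.
  exists (`|M| + 1) => // z Kz; apply: (HM (`|M| + 1)); last by exists z.
  by rewrite (le_lt_trans (ler_norm M)) // ltrDl.
have [M1 M10 H1] := bnd _ continuous_Re.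
have [M2 M20 H2] := bnd _ continuous_Im.
exists ((M1 + M1) + (M2 + M2)) => [|z w Kz Kw]; first by rewrite !addr_ge0.
by rewrite (le_trans (cdist_Re_Im _ _)) // lerD // (le_trans (ler_normB _ _)) //
  lerD // ?H1 ?H2.
Qed.

End Plane.

(** * Homotheties and existence of their attractor *)

Section Homotheties.
Context {R : realType}.
Implicit Types (r : R) (a z w : R[i]) (A B : set R[i]).
Local Notation C := (R[i]^o).

Definition homothety r a z : R[i] := r%:C%C * z + (1 - r)%:C%C * a.

Lemma homothetyE r a z : homothety r a z =
  Complex (r * complex.Re z + (1 - r) * complex.Re a)
          (r * complex.Im z + (1 - r) * complex.Im a).
Proof.
case: a z => [a b] [x y]; rewrite /homothety; apply/eqP.
by rewrite eq_complex /= !mul0r !subr0 !addr0 !eqxx.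
Qed.

Lemma homothety_fix r a : homothety r a a = a.
Proof.
rewrite homothetyE; case: a => x y /=.
by rewrite -!mulrDl addrC subrK !mul1r.
Qed.

Lemma homothety_inj r a : r != 0 -> injective (homothety r a).
Proof.
move=> r0 z w /addIr/mulfI; apply; apply: contra_neq r0 => /eqP.
by rewrite eq_complex /= => /andP[/eqP ->].
Qed.

Lemma cdist_homothety r a z w : 0 <= r ->
  cdist (homothety r a z) (homothety r a w) = r * cdist z w.
Proof.
move=> r0; rewrite /cdist /homothety opprD addrACA subrr addr0 -mulrBr normrM.
rewrite (_ : `|r%:C%C| = r%:C%C); last by rewrite ger0_norm // lecE /= eqxx.
by rewrite normc_def /= mul0r subr0.
Qed.

Lemma continuous_homothety r a : 0 <= r <= 1 ->
  continuous (homothety r a : C -> C).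
Proof.
move=> /andP[r0 r1] z; have F : Filter (nbhs (z : C)) := nbhs_filter _.
apply/(@cvgrPdist_lt _ C _ _ F) => e; rewrite ltcE /= => /andP[/eqP e2 e0].
apply: (@filterS _ _ (nbhs_filter (z : C)) _ _ _ (near_cdist z _ e0)) => w zw.
rewrite [X in X < _]cdistE ltcE /= e2 eqxx /= cdist_homothety //.
by apply: le_lt_trans zw; rewrite ler_piMl // cdist_ge0.
Qed.

(** A compact convex set containing every vertex of the polygon, hence mapped into itself by the
    homotheties centred there. As a product of segments it is readily seen to be compact. *)
Definition unit_square : set R[i] :=
  [set z | `|complex.Re z| <= 1 /\ `|complex.Im z| <= 1].

Lemma compact_unit_square : compact (unit_square : set C).
Proof.
rewrite (_ : unit_square = (fun p : R * R => Complex p.1 p.2) @`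
    (`[-1, 1] `*` `[-1, 1])).
  apply: (@continuous_compact (R * R)%type C).
    exact/continuous_subspaceT/continuous_Complex.
  by apply: compact_setX; exact: segment_compact.
apply/seteqP; split=> [[x y] [/= x1 y1]|_ [[x y] [/= x1 y1] <-]].
  by exists (x, y) => //=; rewrite !in_itv /= -!ler_norml.
by move: x1 y1; rewrite !in_itv /= -!ler_norml.
Qed.

Lemma homothety_unit_square r a z : 0 <= r <= 1 -> unit_square a ->
  unit_square z -> unit_square (homothety r a z).
Proof.
move=> r01; case: a z => [a b] [x y]; rewrite /unit_square homothetyE /=.
by rewrite !ler_norml => -[/andP[? ?] /andP[? ?]] [/andP[? ?] /andP[? ?]];
  split; apply/andP; split; nra.
Qed.

Section Existence.
Variables (n : nat) (r : R) (a : nat -> R[i]).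
Hypotheses (r01 : 0 < r <= 1) (n0 : (0 < n)%N)
  (asq : forall k, unit_square (a k)).

Let Phi A : set R[i] :=
  \bigcup_(k in [set k | (1 <= k <= n)%N]) homothety r (a k) @` A.
Let L j := iter j Phi unit_square.

Let r01' : 0 <= r <= 1. Proof. by case/andP: r01 => /ltW -> ->. Qed.

Let PhiS A B : A `<=` B -> Phi A `<=` Phi B.
Proof. by move=> AB x [k kn [y Ay <-]]; exists k => //; exists y => //; exact: AB. Qed.

Let LS j : L j.+1 `<=` L j.
Proof.
elim: j => [|j IH]; last exact: PhiS.
by move=> x [k kn [y Ay <-]]; exact: homothety_unit_square.
Qed.

Let Lle i j : (i <= j)%N -> L j `<=` L i.
Proof.
move=> /subnK <-; elim: (j - i)%N => // k IH.
by apply: subset_trans IH; rewrite addSn; exact: LS.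
Qed.

Let compactL j : compact (L j : set C).
Proof.
elim: j => [|j IH]; first exact: compact_unit_square.
rewrite /L iterS -/(L j) /Phi.
rewrite (_ : [set k | (1 <= k <= n)%N] = [set` iota 1 n]); last first.
  by apply/seteqP; split=> k /=; rewrite mem_iota add1n ltnS.
rewrite bigcup_seq; apply: (@bigsetU_compact C) => k _.
by apply: (@continuous_compact C C) => //;
  exact/continuous_subspaceT/continuous_homothety.
Qed.

(* Decreasing intersection of the iterates of the Hutchinson operator on an
   invariant square; the converse inclusion is a pigeonhole on the index k. *)
Lemma is_attractor_homotheties :
  is_attractor n (fun k => homothety r (a k)) (\bigcap_j L j).
Proof.
split.
- exists (a 1%N) => j _; elim: j => [|j IH]; first exact: asq.
  by exists 1%N => //; exists (a 1%N) => //; rewrite homothety_fix.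
- apply: (@subclosed_compact C _ unit_square).
  + apply: closed_bigI => j _; apply: compact_closed (compactL j).
    exact: norm_hausdorff.
  + exact: compact_unit_square.
  + by move=> x /(_ 0%N I).
- apply/seteqP; split=> [x Kx|x [k kn [y Ky <-]] j _]; last first.
    by case: j => [|j]; [apply: (LS 0)|]; exists k => //; exists y => //; exact: Ky.
  have [[k [kn Hk]]|/forallNP H] := pselect (exists k, (1 <= k <= n)%N /\
      forall j, (homothety r (a k) @` L j) x).
    have [y _ yx] := Hk 0%N.
    exists k => //; exists y => // j _.
    (* By injectivity the preimage of [x] is the same point at every level, so it lies in the
       intersection. *)
    have [y' Ly' y'x] := Hk j.
    suff <- : y' = y by [].
    by apply: (@homothety_inj r (a k)); [case/andP: r01 => /lt0r_neq0|rewrite y'x].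
  have /choice[J HJ] k : exists j, (1 <= k <= n)%N -> ~ (homothety r (a k) @` L j) x.
    case: (boolP (1 <= k <= n)%N) => [kn|]; last by exists 0%N.
    have /not_andP[//|/existsNP[j Hj]] := H k; by exists j.
  have [k kn [y Ly yx]] := Kx (\max_(k < n.+1) J k).+1 I.
  case: (HJ k kn); exists y => //; apply: Lle Ly.
  by case/andP: kn => _; rewrite -ltnS => kn; apply: (leq_bigmax (Ordinal kn)).
Qed.

End Existence.
End Homotheties.

(** * Bounds for the Hausdorff dimension *)

Section HausdorffDimension.
Context {R : realType}.
Implicit Types (z w : R[i]) (A : set R[i]) (s d r e : R).

Lemma diam_ge0 A : (0 <= diam A)%E.
Proof. by rewrite /diam le_max lexx. Qed.

Lemma cdist_le_diam A z w : A z -> A w -> ((cdist z w)%:E <= diam A)%E.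
Proof.
move=> Az Aw; rewrite /diam le_max; apply/orP; right.
by apply: ereal_sup_ubound; exists (z, w).
Qed.

Lemma diam_le A d : 0 <= d ->
  (forall z w, A z -> A w -> cdist z w <= d) -> (diam A <= d%:E)%E.
Proof.
move=> d0 Ad; rewrite /diam ge_max lee_fin d0 /=.
by apply: ge_ereal_sup => _ [[z w] [/= Az Aw] <-]; rewrite lee_fin Ad.
Qed.

Lemma diam_pow_ge0 s A : (0 <= diam_pow s A)%E.
Proof. by rewrite /diam_pow; case: ifP => // _; exact: poweR_ge0. Qed.

Lemma diam_pow_le s d A : 0 <= s -> 0 <= d ->
  (forall z w, A z -> A w -> cdist z w <= d) ->
  (diam_pow s A <= (d `^ s)%:E)%E.
Proof.
move=> s0 d0 Ad; rewrite /diam_pow; case: ifP => _.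
  by rewrite lee_fin powR_ge0.
rewrite -poweR_EFin; apply: gt0_ler_poweR => //.
- by rewrite in_itv /= diam_ge0 leey.
- by rewrite in_itv /= lee_fin d0 leey.
- exact: diam_le.
Qed.

Lemma hausdorff_premeasure_ge0 s d A : (0 <= hausdorff_premeasure s d A)%E.
Proof.
apply: le_ereal_inf_tmp => _ [U _ <-].
by apply: nneseries_ge0 => i _ _; exact: diam_pow_ge0.
Qed.

Lemma hausdorff_measure_eq0 s A :
  (forall d e, 0 < d -> 0 < e -> (hausdorff_premeasure s d A <= e%:E)%E) ->
  hausdorff_measure s A = 0%E.
Proof.
move=> H; apply/eqP; rewrite eq_le; apply/andP; split.
  apply: ge_ereal_sup => _ [d d0 <-].
  by apply/lee_addgt0Pr => e e0; rewrite add0e; exact: H.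
apply: (@le_trans _ _ (hausdorff_premeasure s 1 A)).
  exact: hausdorff_premeasure_ge0.
by apply: ereal_sup_ubound; exists 1 => //=.
Qed.

(* Re is 1-Lipschitz, so U projects into an interval of length 2 diam U, and
   diam U <= (diam U)^s as soon as diam U <= 1. *)
Lemma Re_interval_cover s A : 0 <= s <= 1 -> (diam A <= 1%:E)%E ->
  exists V : set R, [/\ measurable V, @complex.Re R @` A `<=` V &
    (lebesgue_measure V <= 2%:E * diam_pow s A)%E].
Proof.
move=> /andP[s0 s1] dA1.
have [->|A0] := eqVneq A set0.
  exists set0; split => //; first by rewrite image_set0.
  by rewrite measure0 mule_ge0 // diam_pow_ge0.
have /set0P[z0 Az0] := A0.
have dAfin : diam A \is a fin_num.
  by rewrite ge0_fin_numE ?diam_ge0 // (le_lt_trans dA1) // ltry.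
set d := fine (diam A).
have dE : diam A = d%:E by rewrite fineK.
have d0 : 0 <= d by rewrite fine_ge0 // diam_ge0.
have d1 : d <= 1 by rewrite -lee_fin -dE.
exists `[complex.Re z0 - d, complex.Re z0 + d]%classic; split => //.
- move=> _ [z Az <-] /=; rewrite in_itv /= -ler_distl.
  by rewrite (le_trans (Re_cdist z z0)) // -lee_fin -dE cdist_le_diam.
- rewrite lebesgue_measure_itv /= lte_fin.
  case: ifP => _; last by rewrite mule_ge0 // diam_pow_ge0.
  rewrite -EFinB /diam_pow (negbTE A0) dE poweR_EFin -EFinM lee_fin.
  have -> : complex.Re z0 + d - (complex.Re z0 - d) = 2 * d by ring.
  rewrite ler_pM2l //; move: d0; rewrite le_eqVlt => /predU1P[<-|d0].
    exact: powR_ge0.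
  by rewrite ger1_powR // d0.
Qed.

(** If the measure vanished for some [s < 1], a cover with sum below [(b - a) / 4] would project
    into intervals of total length below [(b - a) / 2], against countable subadditivity of Lebesgue
    measure on [[a, b]]. *)
Lemma hausdorff_dim_ge1 A (a b : R) : a < b ->
  `[a, b]%classic `<=` @complex.Re R @` A -> (1%:E <= hausdorff_dim A)%E.
Proof.
move=> ab abA; apply: le_ereal_inf_tmp => _ [s [s0 sA] <-].
rewrite lee_fin leNgt; apply/negP => s1.
have e0 : 0 < (b - a) / 4 by rewrite divr_gt0 // subr_gt0.
have : (hausdorff_premeasure s 1 A < ((b - a) / 4)%:E)%E.
  apply: (@le_lt_trans _ _ 0%E); last by rewrite lte_fin.
  by rewrite -sA; apply: ereal_sup_ubound; exists 1 => //=.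
move=> /ereal_inf_lt[_ [U [U1 AU] <-] Ue].
have /choice[V HV] : forall i, exists V : set R, [/\ measurable V,
    @complex.Re R @` U i `<=` V &
    (lebesgue_measure V <= 2%:E * diam_pow s (U i))%E].
  by move=> i; apply: Re_interval_cover; rewrite ?s0 ?(ltW s1).
have abV : `[a, b]%classic `<=` \bigcup_i V i.
  move=> x /abA[z /AU[i _ Uz] <-]; exists i => //.
  by have [_ + _] := HV i; apply; exists z.
have : (lebesgue_measure `[a, b]%classic <=
    \sum_(0 <= i <oo) lebesgue_measure (V i))%E.
  apply: measure_sigma_subadditive => // i; by have [] := HV i.
rewrite lebesgue_measure_itv /= lte_fin ab; apply/negP; rewrite -ltNge.
apply: (@le_lt_trans _ _ (\sum_(0 <= i <oo) (2%:E * diam_pow s (U i)))%E).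
  by apply: lee_nneseries => i => [_ _|_]; [exact: measure_ge0|have [] := HV i].
rewrite nneseriesZl; last by move=> i _; exact: diam_pow_ge0.
apply: (@lt_le_trans _ _ (2%:E * ((b - a) / 4)%:E)%E).
  by rewrite lte_pmul2l // lte_fin.
rewrite -EFinM -EFinB lee_fin; move: ab; lra.
Qed.

Lemma near_geometric_le (q M e : R) : 0 <= q < 1 -> 0 < e ->
  \forall k \near \oo, q ^+ k * M <= e.
Proof.
move=> /andP[q0 q1] e0.
have : q ^+ k * M @[k --> \oo] --> (0 * M : R).
  by apply: cvgMl; apply: cvg_expr; rewrite ger0_norm.
by rewrite mul0r => /cvgrPdist_le/(_ e e0); apply: filterS => k;
  rewrite sub0r normrN; exact/le_trans/ler_norm.
Qed.

(** * Attractors of homotheties with a common ratio: dimension and projection *)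

Section SelfSimilar.
Variables (n : nat) (r : R) (a : nat -> R[i]) (K : set R[i]).
Hypotheses (n0 : (0 < n)%N) (r01 : 0 < r < 1)
  (Katt : is_attractor n (fun k => homothety r (a k)) K).

(* The digits of i in base n spell the word of the level-k piece; the pieces of
   index i >= n ^ k are empty. *)
Fixpoint cylinder (k i : nat) : set R[i] :=
  if k is k'.+1 then homothety r (a (i %% n)%N.+1) @` cylinder k' (i %/ n)%N
  else if i == 0%N then K else set0.

Lemma cylinder_cover k : K `<=` \bigcup_i cylinder k i.
Proof.
case: Katt => _ _ KE; elim: k => [|k IH] x; first by exists 0%N.
rewrite [X in X x]KE => -[[|j] // /andP[_ jn] [y /IH[i _ yi] <-]].
(* The outermost map is the lowest digit; digits start at 0 whereas maps are numbered from 1. *)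
exists (i * n + j)%N => //=.
by rewrite modnMDl modn_small // divnMDl // divn_small // addn0; exists y.
Qed.

Lemma cylinder_eq0 k i : (n ^ k <= i)%N -> cylinder k i = set0.
Proof.
elim: k i => [|k IH] i /=; first by case: i.
by rewrite expnSr -leq_divRL // => /IH ->; rewrite image_set0.
Qed.

Lemma cylinder_cdist D k i z w : (forall x y, K x -> K y -> cdist x y <= D) ->
  cylinder k i z -> cylinder k i w -> cdist z w <= r ^+ k * D.
Proof.
have /andP[/ltW r0 _] := r01.
move=> HD; elim: k i z w => [|k IH] i z w /=.
  by case: ifP => // _ Kz Kw; rewrite mul1r HD.
move=> [z' z'i <-] [w' w'i <-]; rewrite cdist_homothety // exprS -mulrA.
by rewrite ler_wpM2l // (IH _ _ _ z'i w'i).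
Qed.

Lemma cylinder_sum s D k : 0 <= s -> 0 <= D ->
  (forall x y, K x -> K y -> cdist x y <= D) ->
  (\sum_(0 <= i <oo) diam_pow s (cylinder k i) <=
    ((n%:R * r `^ s) ^+ k * D `^ s)%:E)%E.
Proof.
have /andP[/ltW r0 _] := r01.
move=> s0 D0 HD.
rewrite (nneseries_split 0 (n ^ k)); last by move=> *; exact: diam_pow_ge0.
(* The tail consists of empty pieces, which contribute 0 even when [s = 0]. *)
rewrite add0n [X in (_ + X)%E]eseries0 ?adde0; last first.
  by move=> i ik _; rewrite cylinder_eq0 // /diam_pow eqxx.
apply: (@le_trans _ _ (\sum_(0 <= i < n ^ k) ((r ^+ k * D) `^ s)%:E)%E).
  apply: lee_sum => i _; apply: diam_pow_le => //.
    by rewrite mulr_ge0 // exprn_ge0.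
  by move=> z w; exact: cylinder_cdist.
rewrite sumEFin lee_fin big_const_nat subn0 iter_addr_0 powRM ?exprn_ge0 //.
rewrite -[X in X <= _]mulr_natl natrX mulrA exprMn.
suff -> : (r ^+ k) `^ s = (r `^ s) ^+ k by [].
by rewrite -[r ^+ k]powR_mulrn // -powRrM mulrC powRrM powR_mulrn ?powR_ge0.
Qed.

Lemma hausdorff_dim_le s : 0 <= s -> n%:R * r `^ s < 1 ->
  (hausdorff_dim K <= s%:E)%E.
Proof.
have /andP[/ltW r0 r1] := r01.
move=> s0 ns1; apply: ereal_inf_lbound; exists s => //; split => //.
have [_ /compact_cdist_bounded[D D0 HD] _] := Katt.
apply: hausdorff_measure_eq0 => d e d0 e0.
have q01 : 0 <= n%:R * r `^ s < 1 by rewrite mulr_ge0 ?powR_ge0.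
have r01' : 0 <= r < 1 by rewrite r0.
near \oo => k.
apply: (@le_trans _ _ ((n%:R * r `^ s) ^+ k * D `^ s)%:E); last first.
  by rewrite lee_fin; near: k; exact: near_geometric_le.
apply: le_trans (cylinder_sum s D k s0 D0 HD).
apply: ereal_inf_lbound; exists (cylinder k) => //.
split; last exact: cylinder_cover.
move=> i; apply: (@le_trans _ _ (r ^+ k * D)%:E).
  apply: diam_le; first by rewrite mulr_ge0 // exprn_ge0.
  by move=> z w; exact: cylinder_cdist.
by rewrite lee_fin; near: k; exact: near_geometric_le.
Unshelve. all: by end_near. Qed.

(* Iterating the covering hypothesis approximates every point of [alpha, beta]
   by points of Re K, which is compact. *)
Lemma Re_attractor_itv (alpha beta : R) :
  (forall x, alpha <= x <= beta -> exists k, (1 <= k <= n)%N /\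
     alpha <= (x - (1 - r) * complex.Re (a k)) / r <= beta) ->
  `[alpha, beta]%classic `<=` @complex.Re R @` K.
Proof.
have /andP[r0 r1] := r01.
have [[z0 Kz0] cK KE] := Katt => Hcov x0 /=; rewrite in_itv /= => x0ab.
have clQ : closed (@complex.Re R @` K : set R^o).
  apply: compact_closed; first exact: norm_hausdorff.
  apply: (@continuous_compact (R[i]^o) R^o) => //.
  exact/continuous_subspaceT/continuous_Re.
(* [M] bounds the error at level 0, where every point is approximated by the one point [z0]; each
   further level multiplies the error by [r]. *)
set M := `|alpha| + `|beta| + `|complex.Re z0|.
have approx k : forall x, alpha <= x <= beta ->
    exists2 z, K z & `|x - complex.Re z| <= r ^+ k * M.
  elim: k => [|k IH] x xab.
    exists z0 => //; rewrite expr0 mul1r.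
    apply: le_trans (ler_normB _ _) _; rewrite lerD2r ler_norml.
    have := ler_norm alpha; have := ler_norm (- alpha); rewrite normrN.
    have := ler_norm beta; have := ler_norm (- beta); rewrite normrN.
    case/andP: xab => ? ?; lra.
  have [j [jn /IH[z Kz Hz]]] := Hcov x xab.
  exists (homothety r (a j) z).
    by rewrite KE; exists j => //; exists z.
  rewrite homothetyE /= exprS -mulrA.
  set y := (X in `|X - _|) in Hz.
  have -> : x = r * y + (1 - r) * complex.Re (a j).
    by rewrite /y mulrCA divff ?gt_eqF // mulr1 subrK.
  rewrite opprD addrACA subrr addr0 -mulrBr normrM gtr0_norm //.
  by rewrite ler_pM2l.
apply: clQ => /= B /nbhs_ballP[e e0 eB].
near \oo => k.
have [z Kz Hz] := approx k x0 x0ab.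
exists (complex.Re z); split; first by exists z.
apply: eB; rewrite -ball_normE /=; apply: le_lt_trans Hz _.
apply: (@le_lt_trans _ _ (e / 2)); last by rewrite ltr_pdivrMr // ltr_pMr // ltr1n.
near: k; apply: near_geometric_le; first by rewrite ltW.
by rewrite divr_gt0.
Unshelve. all: by end_near. Qed.

End SelfSimilar.
End HausdorffDimension.

(** * Trigonometric estimates for the ratio and the projected covering *)

Section Ratio.
Context {R : realType}.
Implicit Types (x y : R) (n m k : nat).

Lemma ler_cos_norm x y : `|x| <= `|y| -> `|y| <= pi -> cos y <= cos x.
Proof.
move=> xy ypi; rewrite -(cos_norm x) -(cos_norm y) leNgt ltr_cos -?leNgt //.
  by rewrite in_itv /= normr_ge0.
by rewrite in_itv /= normr_ge0 (le_trans xy).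
Qed.

Lemma sin_le_id x : 0 <= x -> sin x <= x.
Proof.
move=> x0.
have [|c _] := @MVT_segment R sin cos 0 x x0 (fun y _ => is_derive_sin y).
  by apply: continuous_subspaceT; exact: continuous_sin.
by rewrite sin0 !subr0 => ->; rewrite ler_piMl // cos_le1.
Qed.

Lemma sin_mulM_cos x y : 2 * cos y * sin x = sin (x + y) + sin (x - y).
Proof. by rewrite sinD sinB; ring. Qed.

Lemma cosB_cosD x y : cos (x - y) - cos (x + y) = 2 * sin x * sin y.
Proof. by rewrite cosB cosD; ring. Qed.

(* The multiples of pi / n avoid pi / 2 by at least pi / (2 n). *)
Lemma sin_mul_pi_odd n j : odd n -> (j <= n)%N ->
  sin (j%:R * (pi / n%:R)) <= cos (pi / n%:R / 2) :> R.
Proof.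
move=> on jn; have n0 : (0 < n)%N by case: n on jn.
have nR0 : 0 < n%:R :> R by rewrite ltr0n.
rewrite -cosBpihalf; set t := pi / n%:R.
have t0 : 0 < t by rewrite divr_gt0 // pi_gt0.
have tn : n%:R * t = pi by rewrite /t mulrCA divff ?mulr1 // gt_eqF.
rewrite -tn (_ : _ - _ = (j.*2%:R - n%:R) * (t / 2)); last first.
  by rewrite -muln2 natrM; field.
have jnR : j%:R <= n%:R :> R by rewrite ler_nat.
apply: ler_cos_norm.
  rewrite [leRHS]normrM ler_peMl //.
  (* Since [n] is odd, [2 j - n] is a nonzero integer, so its absolute value is at least 1. *)
  have : (j.*2 != n) by apply: contraTneq on => <-; rewrite odd_double.
  rewrite neq_ltn ler_normr => /orP[jn2|jn2]; apply/orP; [right|left].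
    by rewrite opprB lerBrDr addrC natr1 ler_nat.
  by rewrite lerBrDr addrC natr1 ler_nat.
have t20 : 0 < t / 2 by rewrite divr_gt0.
rewrite normrM (gtr0_norm t20).
have j2n : `|j.*2%:R - n%:R| <= n%:R :> R.
  rewrite -muln2 natrM ler_norml; apply/andP; split; last by move: jnR; lra.
  by rewrite lerBrDr addNr mulr_ge0.
apply: le_trans (ler_wpM2r (ltW t20) j2n) _.
by rewrite -tn ler_pM2l //; move: t0; lra.
Qed.

Section Regime.
Variables n m : nat.
Hypotheses (n4 : (4 <= n)%N) (m1 : (1 <= m)%N) (mn2 : m%:R <= n%:R / 2 :> R)
  (mn4 : n%:R / 4 <= m%:R :> R) (mn41 : m%:R <= n%:R / 4 + 1 :> R).

Let t : R := pi / n%:R.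
Let s : R := sin t.
Let S : R := sin ((2 * m - 1)%N%:R * t).
Let P : R := ngon_ratio R n m.

Let n0 : 0 < n%:R :> R. Proof. by rewrite ltr0n (leq_trans _ n4). Qed.
Let nR4 : 4 <= n%:R :> R. Proof. by rewrite ler_nat. Qed.
Let t0 : 0 < t. Proof. by rewrite divr_gt0 // pi_gt0. Qed.
Let tn : n%:R * t = pi. Proof. by rewrite /t mulrCA divff ?mulr1 // gt_eqF. Qed.

Let s0 : 0 < s.
Proof. by rewrite sin_gt0_pi // t0 -tn ltr_pMl //=; move: nR4; lra. Qed.

Let jE : (2 * m - 1)%N%:R = 2 * m%:R - 1 :> R.
Proof. by rewrite natrB ?natrM // muln_gt0. Qed.

(** The bounds [n / 4 <= m <= n / 4 + 1] place [(2 m - 1) t] within [t] of [pi / 2], so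
    [S >= cos t]. As [n >= 4], [cos (2 t) >= 0], whence [cos t >= cos t ^ 2 >= 1 / 2]. *)
Let S_ge : 2^-1 <= S.
Proof.
have tpi : 2 * t <= pi / 2 by rewrite -tn; move: nR4 t0; nra.
have ct0 : 0 <= cos t by apply: cos_ge0_pihalf; apply/andP; split; move: t0; lra.
have c2t : 0 <= cos (t *+ 2).
  by apply: cos_ge0_pihalf; rewrite -mulr_natl; apply/andP; split; move: t0; lra.
have ct : 2^-1 <= cos t.
  have := cos_le1 t; move: c2t; rewrite cos_mulr2n -mulr_natl; nra.
apply: le_trans ct _; rewrite /S -cosBpihalf; apply: ler_cos_norm.
  rewrite (gtr0_norm t0) -tn jE.
  have -> : (2 * m%:R - 1) * t - n%:R * t / 2 = (2 * m%:R - 1 - n%:R / 2) * t by field.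
  rewrite normrM (gtr0_norm t0) ler_piMl ?(ltW t0) // ler_norml.
  apply/andP; split; move: mn4 mn41; lra.
rewrite gtr0_norm //; move: tpi t0; lra.
Qed.

(** Product-to-sum for the angles [m t] and [(m - 1) t], whose sum is [(2 m - 1) t] and difference
    [t]. *)
Let P_E : P = s / (S + s).
Proof.
rewrite /P /ngon_ratio -!mulrA -/t mulrA sin_mulM_cos /S /s jE.
by congr (_ / (sin _ + sin _)); ring.
Qed.

Let Ss0 : 0 < S + s. Proof. by move: S_ge s0; lra. Qed.
Let S0 : 0 < S. Proof. by move: S_ge; lra. Qed.

Let P1 : 1 - P = S / (S + s).
Proof. by rewrite P_E; field; rewrite gt_eqF. Qed.

Lemma ngon_ratio_itv : 0 < P < 1.
Proof.
rewrite -[P < 1]subr_gt0 P1 P_E.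
by rewrite !divr_gt0.
Qed.

(** The numerator is at most [pi / n < 4 / n] and the denominator [S + s] at least [1 / 2]. *)
Lemma ngon_ratio_le : P <= 8 / n%:R.
Proof.
rewrite P_E ler_pdivrMr //.
have st : s <= t by apply: sin_le_id; exact: ltW.
apply: le_trans st _; rewrite /t mulrAC ler_pM2r ?invr_gt0 //.
have := pihalf_lt2 R; move: S_ge s0; nra.
Qed.

Let c k : R := cos (2 * pi * k%:R / n%:R).
(** Index of a leftmost vertex: the projected hull is [[c h, 1]]. *)
Let h := n./2.

Let c_E k : c k = cos (2 * k%:R * t).
Proof. by rewrite /c /t; congr cos; field; rewrite gt_eqF. Qed.

(* This is where the ratio is critical: consecutive projected pieces just
   touch in the worst case. *)
Let gap k : (k < h)%N ->
  (1 - P) * (c k - c k.+1) <= P * (1 - c h).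
Proof.
move=> kh; rewrite P1 P_E ![_ / (S + s) * _]mulrAC ler_pM2r ?invr_gt0 //.
have khn : (k.*2.+1 < n)%N.
  rewrite -[X in (_ < X)%N](odd_double_half n); apply: leq_trans (leq_addl _ _).
  by rewrite -doubleS leq_double.
have -> : c k - c k.+1 = 2 * sin (k.*2.+1%:R * t) * s.
  rewrite !c_E -cosB_cosD -!natr1 -muln2 natrM.
  by congr (cos _ - cos _); ring.
rewrite mulrA [leRHS]mulrC ler_pM2r //.
set u := sin _.
(* It remains to show [2 u S <= 1 - c h]. For odd [n] the right-hand side is
   [1 + cos t = 2 cos (t / 2) ^ 2], and both sines are at most [cos (t / 2)]. *)
have [on|en] := boolP (odd n).
  have uk : u <= cos (t / 2) by apply: sin_mul_pi_odd => //; exact: ltnW.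
  have Sk : S <= cos (t / 2).
    apply: sin_mul_pi_odd => //; rewrite -(ler_nat R) jE; move: mn2; lra.
  have -> : c h = - cos t.
    have hE : 2 * h%:R = n%:R - 1 :> R.
      rewrite -[X in X%:R - 1]odd_double_half on -muln2 natrD natrM /= /h; ring.
    rewrite c_E hE mulrBl tn mul1r cosB cospi sinpi; ring.
  have -> : cos t = 2 * cos (t / 2) ^+ 2 - 1.
    have {1}-> : t = (t / 2) *+ 2 by rewrite -mulr_natl; field.
    by rewrite cos_mulr2n mulr_natl.
  have := ler_wpM2l (ltW S0) uk.
  have := ler_wpM2r (le_trans (ltW S0) Sk) Sk.
  rewrite expr2; lra.
(* For even [n] the right-hand side is 2, and bounding the sines by 1 is enough. *)
have -> : c h = - 1.
  have hE : 2 * h%:R = n%:R :> R.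
    by rewrite -[X in _ = X%:R]odd_double_half (negbTE en) -muln2 natrM /= mulrC.
  by rewrite c_E hE tn cospi.
have := sin_le1 ((2 * m - 1)%N%:R * t); have := sin_le1 (k.*2.+1%:R * t).
rewrite -/S -/u; move: S0; nra.
Qed.

(** The vertices [0..h] suffice, their projections running from 1 down to [c h]. Take the least [k]
    whose piece starts at or left of [x]: either [k = 0] and the piece ends at 1, or the preceding
    piece starts right of [x] and [gap] puts [x] before the end of piece [k]. *)
Lemma ngon_cover x : c h <= x <= 1 -> exists k, (1 <= k <= n)%N /\
  c h <= (x - (1 - P) * complex.Re (ngon_vertex R n k)) / P <= 1.
Proof.
have /andP[Pgt0 Plt1] := ngon_ratio_itv.
move=> /andP[hx x1].
suff [k kh /andP[lo hi]] : exists2 k, (k <= h)%N &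
    P * c h + (1 - P) * c k <= x <= P + (1 - P) * c k.
  (* The maps are numbered from 1 to [n], so vertex 0 appears as vertex [n]. *)
  exists (if k == 0%N then n else k); split.
    case: eqP => [_|]; first by rewrite leqnn andbT (leq_trans _ n4).
    move/eqP; rewrite -lt0n => -> /=; apply: leq_trans kh _.
    by rewrite /h -divn2 leq_div.
  have -> : complex.Re (ngon_vertex R n (if k == 0%N then n else k)) = c k.
    rewrite /ngon_vertex /=; case: eqP => // ->.
    rewrite /c mulfK ?gt_eqF // mulr0 mul0r cos0.
    by rewrite mulr_natl cos2pi.
  rewrite ler_pdivlMr // ler_pdivrMr //; apply/andP; split; lra.
have exk : exists k, P * c h + (1 - P) * c k <= x.
  by exists h; rewrite -mulrDl subrKC mul1r.
case: (ex_minnP exk) => k Hk kmin; exists k.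
  by apply: kmin; rewrite -mulrDl subrKC mul1r.
rewrite Hk /=; case: k Hk kmin => [|k] Hk kmin.
  by rewrite /c mulr0 mul0r cos0 mulr1 subrKC.
have kh : (k < h)%N by apply: kmin; rewrite -mulrDl subrKC mul1r.
have : ~~ (P * c h + (1 - P) * c k <= x).
  by apply/negP => /kmin; rewrite ltnn.
rewrite -ltNge => xk; have := gap k kh; move: xk; lra.
Qed.

Lemma ngon_c_lt1 : c h < 1.
Proof.
have h0 : (0 < h)%N by rewrite half_gt0 (leq_trans _ n4).
have h2n : (2 * h <= n)%N.
  by rewrite -[leqRHS]odd_double_half mul2n leq_addl.
have ht : 0 < 2 * h%:R * t by rewrite mulr_gt0 // mulr_gt0 // ltr0n.
rewrite c_E -[X in _ < X]cos0 ltr_cos // in_itv /= ?lexx ?pi_ge0 //.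
by rewrite (ltW ht) -tn ler_pM2r // -natrM ler_nat.
Qed.

End Regime.
End Ratio.

(** * The Sierpinski polygons and the limit of their dimensions *)

Lemma vertex_unit_square (R : realType) (n k : nat) :
  unit_square (ngon_vertex R n k).
Proof. by split => /=; [exact: cos_max|exact: sin_max]. Qed.

(** Existence of an attractor excludes the default value [set0] of [xget]. *)
Lemma sierpinski_ngonP (R : realType) (n m : nat) : (0 < n)%N ->
  0 < ngon_ratio R n m < 1 ->
  is_attractor n (fun k => homothety (ngon_ratio R n m) (ngon_vertex R n k))
    (sierpinski_ngon R n m).
Proof.
move=> n0 /andP[P0 P1]; rewrite /sierpinski_ngon /attractor.
case: xgetP => [K _ //|/(_ _) H]; exfalso; apply: H.
apply: is_attractor_homotheties => // [|k]; first by rewrite P0 ltW.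
exact: vertex_unit_square.
Qed.

Lemma near_mul_powR_lt1 (R : realType) (s : R) : 1 < s ->
  \forall n \near \oo, n%:R * (8 / n%:R) `^ s < 1.
Proof.
move=> s1; have s10 : 0 < s - 1 by rewrite subr_gt0.
near=> n.
have n0 : 0 < n%:R :> R by near: n; exact: nbhs_infty_gtr.
have sn : 8 `^ s < n%:R `^ (s - 1).
  have -> : 8 `^ s = ((8 `^ s) `^ (s - 1)^-1) `^ (s - 1).
    by rewrite -[RHS]powRrM mulVf ?lt0r_neq0 // powRr1 ?powR_ge0.
  rewrite gt0_ltr_powR // ?nnegrE ?powR_ge0 ?ltW //.
  by near: n; exact: nbhs_infty_gtr.
rewrite powRM ?invr_ge0 ?ltW // -powR_inv1 ?ltW // -powRrM mulN1r mulrCA.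
have -> : n%:R * n%:R `^ (- s) = (n%:R `^ (s - 1))^-1.
  rewrite -[X in X * _]powRr1 ?ltW // -powRD; last by rewrite lt0r_neq0 ?implybT.
  by rewrite -powRN opprB.
by rewrite ltr_pdivrMr ?mul1r // powR_gt0.
Unshelve. all: by end_near. Qed.

Theorem theorem3 (R : realType) (m : nat -> nat)
  (hm : forall n : nat, (2 <= n)%N ->
     [/\ (1 <= m n)%N, (m n)%:R <= n%:R / 2 :> R,
         n%:R / 4 <= (m n)%:R :> R & (m n)%:R <= n%:R / 4 + 1 :> R]) :
  hausdorff_dim (sierpinski_ngon R n (m n)) @[n --> \oo] --> (1%:E : \bar R).
Proof.
have dim_ge1 n : (4 <= n)%N -> (1%:E <= hausdorff_dim (sierpinski_ngon R n (m n)))%E.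
  move=> n4; have [m1 mn2 mn4 mn41] := hm n (leq_trans (isT : (2 <= 4)%N) n4).
  have P01 := ngon_ratio_itv n (m n) n4 m1 mn4 mn41.
  have n0 : (0 < n)%N := leq_trans (isT : (0 < 4)%N) n4.
  apply: (hausdorff_dim_ge1 _ _ _ (ngon_c_lt1 n n4)).
  apply: (Re_attractor_itv _ _ _ _ P01 (sierpinski_ngonP _ _ _ n0 P01)).
  exact: ngon_cover.
have dim_le s : 1 < s ->
    \forall n \near \oo, (hausdorff_dim (sierpinski_ngon R n (m n)) <= s%:E)%E.
  move=> s1; near=> n.
  have n4 : (4 <= n)%N by near: n; exact: nbhs_infty_ge.
  have [m1 mn2 mn4 mn41] := hm n (leq_trans (isT : (2 <= 4)%N) n4).
  have P01 := ngon_ratio_itv n (m n) n4 m1 mn4 mn41.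
  have n0 : (0 < n)%N := leq_trans (isT : (0 < 4)%N) n4.
  have s0 : 0 <= s by rewrite ltW // (lt_trans _ s1).
  apply: (hausdorff_dim_le _ _ _ _ n0 P01 (sierpinski_ngonP _ _ _ n0 P01)) => //.
  apply: (@le_lt_trans _ _ (n%:R * (8 / n%:R) `^ s)); last first.
    by near: n; exact: near_mul_powR_lt1.
  rewrite ler_wpM2l // ge0_ler_powR ?nnegrE //.
  - by case/andP: P01 => /ltW.
  - exact: ngon_ratio_le.
(* Convergence to a finite limit in the extended reals: the dimensions are eventually finite, lying
   between 1 and 2, and their real values converge. *)
apply/fine_cvgP; split.
  near=> n; rewrite fin_numE gt_eqF /= ?lt_eqF //.
    apply: (@le_lt_trans _ _ 2%:E); last exact: ltry.
    by near: n; apply: dim_le; rewrite ltr1n.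
  apply: (@lt_le_trans _ _ 1%:E); first exact: ltNyr.
  by apply: dim_ge1; near: n; exact: nbhs_infty_ge.
apply/cvgrPdist_le => e e0; near=> n => /=.
have d1 : (1%:E <= hausdorff_dim (sierpinski_ngon R n (m n)))%E.
  by apply: dim_ge1; near: n; exact: nbhs_infty_ge.
have d2 : (hausdorff_dim (sierpinski_ngon R n (m n)) <= (1 + e)%:E)%E.
  by near: n; apply: dim_le; rewrite ltrDl.
case: (hausdorff_dim _) d1 d2 => [d||] //; rewrite !lee_fin /= => d1 d2.
by rewrite distrC ger0_norm ?subr_ge0 // lerBlDl.
Unshelve. all: by end_near. Qed.
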